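(* Let $T>0$ and let $\underline{k}=(k_0,k_1,\ldots)^\top\in\mathbf{P}$ have only finitely many nonzero entries, so that $k(t)=\mathbf{P}(t)\underline{k}=\sum_{n}k_nP_n(t)$ is a polynomial of degree $m$. Then the convolution operator $$(\mathcal{V}[k]y)(t):=\int_0^t k(t-s)\,y(s)\,ds,\qquad 0\le t\le T,$$ corresponds to an $(m+2)$-banded infinite-dimensional matrix $V[\underline{k}]:\mathbf{P}\to\mathbf{P}$; that is, there is an infinite matrix $V[\underline{k}]=(V[\underline{k}]_{j,n})_{j,n\ge 0}$, with $V[\underline{k}]_{j,n}=0$ whenever $|j-n|>m+2$, which maps $\mathbf{P}$ to $\mathbf{P}$ and satisfies, for every $\underline{y}\in\mathbf{P}$ with $y(t)=\mathbf{P}(t)\underline{y}$, $$(\mathcal{V}[k]y)(t)=\mathbf{P}(t)\,V[\underline{k}]\,\underline{y},\qquad 0\le t\le T.$$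
   Context: Let $\widehat P_n$, $n\ge 0$, denote the Legendre polynomial of degree $n$, orthogonal in $L^2([-1,1])$ with the normalisation $\|\widehat P_n\|_2^2=2/(2n+1)$ (standard convention, $\widehat P_n(1)=1$). The mapped-Legendre polynomials on $[0,T]$ are $P_n(t)=\widehat P_n(2t/T-1)$, and $\mathbf{P}(t)=[P_0(t),P_1(t),\ldots]$ is the associated row of functions (quasimatrix). The coefficient space, also denoted $\mathbf{P}$ (without argument), is the set of complex sequences $\underline{v}=(v_0,v_1,\ldots)^\top$ with $\sum_{n=0}^\infty|v_n|<\infty$; for $\underline{v}\in\mathbf{P}$, $\mathbf{P}(t)\underline{v}:=\sum_{n=0}^\infty v_nP_n(t)$ is a continuous function on $[0,T]$. Indices of vectors and matrices begin at zero. An infinite matrix $L=(L_{jn})_{j,n\ge0}$ is called $b$-banded (banded with bandwidth $b$) if $L_{jn}=0$ whenever $|j-n|>b$. An infinite banded matrix acts on sequences by the usual matrix-vector product, each row of which is a finite sum. *)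

(* Defs.v *)
From Stdlib Require Import Reals Lia.
From Coquelicot Require Export Coquelicot.
Open Scope R_scope.

(* Polynomial functions of a real variable with coefficients in [V] (used for
   [V = R] and [V = C]).  The zero polynomial is given degree [0]. *)
Definition is_poly_of_degree (V : ModuleSpace R_Ring) (f : R -> V) (m : nat) : Prop :=
  exists a : nat -> V,
    (a m <> zero \/ m = 0%nat) /\
    forall t : R, f t = sum_n (fun i => scal (t ^ i) (a i)) m.

Record is_legendre (Phat : nat -> R -> R) : Prop := {
  legendre_degree : forall n, is_poly_of_degree R_ModuleSpace (Phat n) n;
  legendre_orthogonal : forall i j, i <> j ->
    is_RInt (fun x => Phat i x * Phat j x) (-1) 1 0;
  legendre_norm : forall n,
    is_RInt (fun x => Phat n x ^ 2) (-1) 1 (2 / (2 * INR n + 1));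
  legendre_at_1 : forall n, Phat n 1 = 1
}.

Definition mapped_legendre (T : R) (Phat : nat -> R -> R) (n : nat) (t : R) : R :=
  Phat n (2 * t / T - 1).

(* Coquelicot's total [Series] is real-valued; this is its complex counterpart. *)
Definition CSeries (a : nat -> C) : C :=
  (Series (fun n => fst (a n)), Series (fun n => snd (a n))).

Lemma CSeries_unique (a : nat -> C) (l : C) :
  @is_series C_AbsRing C_NormedModule a l -> CSeries a = l.
Proof.
intros H.
assert (S1 : forall n, fst (sum_n a n) = sum_n (fun i => fst (a i)) n).
{ induction n as [|n IH]; [now rewrite !sum_O|].
  rewrite !sum_Sn, <- IH; reflexivity. }
assert (S2 : forall n, snd (sum_n a n) = sum_n (fun i => snd (a i)) n).
{ induction n as [|n IH]; [now rewrite !sum_O|].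
  rewrite !sum_Sn, <- IH; reflexivity. }
unfold CSeries; rewrite (surjective_pairing l).
f_equal; apply is_series_unique, filterlim_locally; intros eps;
  generalize (proj1 (filterlim_locally (U := C_UniformSpace) _ _) H eps);
  apply filter_imp; intros n [H1 H2].
- rewrite <- S1; exact H1.
- rewrite <- S2; exact H2.
Qed.

(* Membership in the coefficient space: absolutely summable complex sequences. *)
Definition in_P (v : nat -> C) : Prop := ex_series (fun n => Cmod (v n)).

Definition P_eval (T : R) (Phat : nat -> R -> R) (v : nat -> C) (t : R) : C :=
  CSeries (fun n => Cmult (v n) (RtoC (mapped_legendre T Phat n t))).

Definition convolution (k y : R -> C) (t : R) : C :=
  @RInt C_R_CompleteNormedModule (fun s => Cmult (k (t - s)) (y s)) 0 t.

Definition banded (b : nat) (L : nat -> nat -> C) : Prop :=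
  forall j n : nat, (j + b < n \/ n + b < j)%nat -> L j n = RtoC 0.

(* For banded [L], every row is a finite sum; see [mat_vec_banded]. *)
Definition mat_vec (L : nat -> nat -> C) (v : nat -> C) (j : nat) : C :=
  CSeries (fun n => Cmult (L j n) (v n)).

Lemma mat_vec_banded (b : nat) (L : nat -> nat -> C) (v : nat -> C) (j : nat) :
  banded b L -> mat_vec L v j = sum_n (fun n => Cmult (L j n) (v n)) (j + b).
Proof.
intros HL; apply CSeries_unique.
eapply filterlim_ext_loc; [|apply filterlim_const].
exists (j + b)%nat; intros n Hn.
induction Hn as [|n Hn IH]; [reflexivity|].
rewrite sum_Sn, <- IH, (HL j (S n)) by lia.
rewrite Cmult_0_l; symmetry; apply Cplus_0_r.
Qed.

(* Main.v *)
Require Import Defs.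
From Stdlib Require Import Reals Arith Lia Lra.
From Coquelicot Require Import Coquelicot.
Open Scope R_scope.

(* Integration from 0 acts on Legendre coefficients by a tridiagonal matrix J,
   since (2n+1) Q_n = Q_(n+1)' - Q_(n-1)', and J is bounded on l^1.  If A
   represents convolution with f', and f(0) = 0, then integration by parts shows
   that A J represents convolution with f.  Hence convolution with t^i is
   represented by i! J^(i+1), of bandwidth i+1, and a polynomial kernel of degree
   m by a matrix of bandwidth m+1.  The exchange of series and integral rests on
   |Q_n| <= 1 on [-1,1]. *)

(** [is_legendre] characterises [Phat] by properties, so a concrete recursive family [legendre] is
    studied and then identified with [Phat]. Building V by repeated multiplication with J avoids any
    formula for its entries: every matrix that occurs is a polynomial in J, and bandwidth and
    boundedness on l^1 are inherited. In the integration by parts both boundary terms vanish: at s =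
    t because f(0) = 0, at s = 0 because the primitive of y is taken from 0. *)

(** * Legendre polynomials *)

(* Computing [(Q_n, Q_n')] together turns the three-term recurrence into a
   first-order one, from which the classical identities follow directly. *)
Fixpoint legendre_pair (n : nat) (x : R) : R * R :=
  match n with
  | O => (1, 0)
  | S p => let (q, d) := legendre_pair p x in
           (x * q + (x ^ 2 - 1) / INR (S p) * d, INR (S p) * q + x * d)
  end.

Definition legendre (n : nat) (x : R) : R := fst (legendre_pair n x).
Definition dlegendre (n : nat) (x : R) : R := snd (legendre_pair n x).

Lemma legendre_S n x :
  legendre (S n) x
  = x * legendre n x + (x ^ 2 - 1) / INR (S n) * dlegendre n x.
Proof.
unfold legendre, dlegendre; cbn [legendre_pair].
now destruct (legendre_pair n x).
Qed.

Lemma dlegendre_S n x :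
  dlegendre (S n) x = INR (S n) * legendre n x + x * dlegendre n x.
Proof.
unfold legendre, dlegendre; cbn [legendre_pair].
now destruct (legendre_pair n x).
Qed.

Lemma INR_S_neq0 n : INR (S n) <> 0.
Proof. apply not_0_INR; discriminate. Qed.

(** The three claims need one joint induction: differentiating the recursion for Q_(n+1) produces
    Q_n'', which only the Legendre equation for Q_n eliminates. [e] is Q_n''. *)
Lemma legendre_derive_ode n :
  exists e : R -> R,
    (forall x, is_derive (legendre n) x (dlegendre n x)) /\
    (forall x, is_derive (dlegendre n) x (e x)) /\
    (forall x, (x ^ 2 - 1) * e x + 2 * x * dlegendre n x
               = INR n * INR (S n) * legendre n x).
Proof.
induction n as [|n [e [HQ [HD HE]]]].
{ exists (fun _ => 0); split; [|split]; intros x.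
  - apply (is_derive_const 1).
  - apply (is_derive_const 0).
  - unfold dlegendre, legendre; simpl; ring. }
assert (Hn := INR_S_neq0 n).
assert (DQ : forall x, Derive (legendre n) x = dlegendre n x)
  by (intros x; apply is_derive_unique, HQ).
assert (DD : forall x, Derive (dlegendre n) x = e x)
  by (intros x; apply is_derive_unique, HD).
assert (EQ : forall x, ex_derive (legendre n) x) by (intros x; eexists; apply HQ).
assert (ED : forall x, ex_derive (dlegendre n) x) by (intros x; eexists; apply HD).
exists (fun x => (INR (S n) + 1) * dlegendre n x + x * e x).
split; [|split]; intros x.
- apply (is_derive_ext
    (fun x => x * legendre n x + (x ^ 2 - 1) / INR (S n) * dlegendre n x)).
  { intros t; now rewrite legendre_S. }
  rewrite dlegendre_S; assert (E := HE x).
  assert (HN : INR n = INR (S n) - 1) by (rewrite S_INR; ring).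
  rewrite HN in E; clear HE HN; revert Hn E; generalize (INR (S n)); intros N HN E.
  auto_derive; [auto|]; rewrite DQ, DD.
  apply Rminus_diag_uniq.
  (* The two sides differ by the residual of the Legendre equation in degree n, divided by [N]. *)
  transitivity (((x ^ 2 - 1) * e x + 2 * x * dlegendre n x
      - (N - 1) * N * legendre n x) / N); [field; auto|].
  rewrite E; field; auto.
- apply (is_derive_ext (fun x => INR (S n) * legendre n x + x * dlegendre n x)).
  { intros t; now rewrite dlegendre_S. }
  generalize (INR (S n)); intros N.
  auto_derive; [auto|]; rewrite DQ, DD; ring.
- rewrite dlegendre_S, legendre_S.
  replace (_ + _) with
    (x * ((x ^ 2 - 1) * e x + 2 * x * dlegendre n x)
     + (INR (S n) + 1) * (x ^ 2 - 1) * dlegendre n x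
     + 2 * x * INR (S n) * legendre n x) by ring.
  rewrite HE, (S_INR (S n)).
  replace (INR n) with (INR (S n) - 1) by (rewrite S_INR; ring).
  field; auto.
Qed.

Lemma is_derive_legendre n x : is_derive (legendre n) x (dlegendre n x).
Proof. destruct (legendre_derive_ode n) as [e [H _]]; apply H. Qed.

Lemma continuous_legendre n x : continuous (legendre n) x.
Proof. apply (ex_derive_continuous (V := R_NormedModule)); eexists; apply is_derive_legendre. Qed.

Lemma dlegendre_SS n x :
  dlegendre (S (S n)) x - dlegendre n x = INR (2 * n + 3) * legendre (S n) x.
Proof.
assert (Hn := INR_S_neq0 n).
rewrite (dlegendre_S (S n)), (dlegendre_S n), (legendre_S n).
rewrite plus_INR, mult_INR, !S_INR in *; simpl (INR 0) in *.
field; auto.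
Qed.

Lemma legendre_bonnet n x :
  x * legendre (S n) x
  = INR (S (S n)) / INR (2 * n + 3) * legendre (S (S n)) x
    + INR (S n) / INR (2 * n + 3) * legendre n x.
Proof.
assert (Hn := INR_S_neq0 n). assert (Hm := INR_S_neq0 (S n)).
rewrite (legendre_S (S n)), (dlegendre_S n), (legendre_S n).
assert (Hp := pos_INR n).
rewrite plus_INR, mult_INR, !S_INR in *; simpl (INR 0) in *.
field; repeat split; apply Rgt_not_eq; lra.
Qed.

Lemma legendre_at_plus1 n : legendre n 1 = 1.
Proof.
induction n as [|n IH]; [reflexivity|].
rewrite legendre_S, IH; unfold Rdiv; ring.
Qed.

(** At -1 the factor x^2 - 1 vanishes and the recursion is multiplication by -1. Since t = 0 is
    mapped to -1, this makes P_(n+2) - P_n vanish at 0. *)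
Lemma legendre_SS_at_minus1 n : legendre (S (S n)) (-1) = legendre n (-1).
Proof. rewrite !legendre_S; unfold Rdiv; ring. Qed.

(* With [s = sqrt (1 - x^2)], the recursion rotates the vector
   [(Q_n, s Q_n' / (n + 1))] by the angle [arccos x]. *)
Lemma legendre_bound n x : -1 <= x <= 1 -> Rabs (legendre n x) <= 1.
Proof.
intros Hx.
assert (H : legendre n x ^ 2 + (1 - x ^ 2) * (dlegendre n x / INR (S n)) ^ 2 <= 1).
{ induction n as [|n IH]; [unfold legendre, dlegendre; simpl; lra|].
  assert (Hn := INR_S_neq0 n).
  (* The rotation keeps the denominator [INR (S n)]; the claim has the larger [INR (S (S n))], which
     only decreases the left side. *)
  apply Rle_trans with
    (legendre (S n) x ^ 2 + (1 - x ^ 2) * (dlegendre (S n) x / INR (S n)) ^ 2).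
  - apply Rplus_le_compat_l, Rmult_le_compat_l; [nra|].
    unfold Rdiv; rewrite !Rpow_mult_distr.
    apply Rmult_le_compat_l; [apply pow2_ge_0|].
    assert (0 < INR (S n)) by (apply lt_0_INR; lia).
    apply pow_incr; split.
    + left; apply Rinv_0_lt_compat, lt_0_INR; lia.
    + apply Rinv_le_contravar; [auto|apply le_INR; lia].
  - rewrite legendre_S, dlegendre_S.
    replace (_ + _) with
      (legendre n x ^ 2 + (1 - x ^ 2) * (dlegendre n x / INR (S n)) ^ 2)
      by (field; auto).
    exact IH. }
rewrite <- (Rabs_R1); apply Rsqr_le_abs_0; unfold Rsqr.
assert (0 <= (1 - x ^ 2) * (dlegendre n x / INR (S n)) ^ 2)
  by (apply Rmult_le_pos; [nra|apply pow2_ge_0]).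
simpl in *; lra.
Qed.

(** Sturm-Liouville argument: [F], which is x^2 - 1 times a Wronskian, vanishes at both endpoints
    and has derivative c Q_i Q_j, where [c] is the difference of the eigenvalues. *)
Lemma legendre_orthogonality i j :
  i <> j -> is_RInt (fun x => legendre i x * legendre j x) (-1) 1 0.
Proof.
intros Hij.
destruct (legendre_derive_ode i) as [ei [Qi [Di Ei]]].
destruct (legendre_derive_ode j) as [ej [Qj [Dj Ej]]].
set (F := fun x => (x ^ 2 - 1)
  * (dlegendre i x * legendre j x - legendre i x * dlegendre j x)).
set (c := INR i * INR (S i) - INR j * INR (S j)).
assert (Hc : c <> 0).
{ unfold c; rewrite !S_INR. assert (INR i <> INR j) by (now apply not_INR).
  assert (0 <= INR i) by apply pos_INR. assert (0 <= INR j) by apply pos_INR.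
  replace (_ - _) with ((INR i - INR j) * (INR i + INR j + 1)) by ring.
  apply Rmult_integral_contrapositive_currified; lra. }
replace 0 with (scal (/ c) (minus (F 1) (F (-1))))
  by (unfold F, scal, minus, plus, opp; simpl; unfold mult; simpl; ring).
apply is_RInt_ext with
  (fun x => scal (/ c) (c * (legendre i x * legendre j x))).
{ intros x _; unfold scal; simpl; unfold mult; simpl; field; auto. }
apply (is_RInt_scal (V := R_NormedModule)).
apply (is_RInt_derive (V := R_CompleteNormedModule)).
- intros x _; unfold F.
  auto_derive.
  { repeat split; eexists; eauto. }
  assert (U : forall (f : R -> R) l, is_derive f x l -> Derive (fun y => f y) x = l)
    by (intros f l; apply is_derive_unique).
  rewrite (U _ _ (Qi x)), (U _ _ (Qj x)), (U _ _ (Di x)), (U _ _ (Dj x)).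
  unfold c. rewrite Rmult_minus_distr_r, <- !Rmult_assoc, <- Ei.
  replace (INR j * INR (S j) * legendre i x * legendre j x)
    with (legendre i x * (INR j * INR (S j) * legendre j x)) by ring.
  rewrite <- Ej; ring.
- intros x _.
  apply (continuous_scal_r c (fun x => legendre i x * legendre j x)).
  apply (continuous_mult (legendre i) (legendre j)); apply continuous_legendre.
Qed.

(** * Finite Legendre expansions and uniqueness of the family *)

Lemma sum_n_single {G : AbelianMonoid} (f : nat -> G) (j n : nat) :
  (j <= n)%nat -> (forall i, i <> j -> f i = zero) -> sum_n f n = f j.
Proof.
intros Hjn Hf.
assert (Hz : forall k, (k < j)%nat -> sum_n f k = zero).
{ induction k as [|k IH]; intros Hk.
  - rewrite sum_O; apply Hf; lia.
  - rewrite sum_Sn, IH, Hf by lia; apply plus_zero_l. }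
induction Hjn as [|n Hjn IH].
- destruct j as [|j]; [apply sum_O|].
  rewrite sum_Sn, Hz by lia; apply plus_zero_l.
- rewrite sum_Sn, IH, (Hf (S n)) by lia; apply plus_zero_r.
Qed.

Lemma is_RInt_sum_n {V : NormedModule R_AbsRing} (f : nat -> R -> V)
    (a b : R) (l : nat -> V) (n : nat) :
  (forall i, is_RInt (f i) a b (l i)) ->
  is_RInt (fun x => sum_n (fun i => f i x) n) a b (sum_n l n).
Proof.
intros H; induction n as [|n IH].
- rewrite sum_O; apply is_RInt_ext with (2 := H O).
  intros x _; now rewrite sum_O.
- rewrite sum_Sn.
  apply is_RInt_ext with (2 := is_RInt_plus _ _ _ _ _ _ IH (H (S n))).
  intros x _; now rewrite sum_Sn.
Qed.

Definition legendre_span (n : nat) (f : R -> R) : Prop :=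
  exists d : nat -> R, forall x, f x = sum_n (fun j => d j * legendre j x) n.

Lemma legendre_span_ext n f g :
  (forall x, f x = g x) -> legendre_span n f -> legendre_span n g.
Proof. intros E [d Hd]; exists d; intros x; now rewrite <- E. Qed.

Lemma legendre_span_plus n f g :
  legendre_span n f -> legendre_span n g -> legendre_span n (fun x => f x + g x).
Proof.
intros [d Hd] [e He]; exists (fun j => d j + e j); intros x.
rewrite Hd, He; etransitivity; [symmetry; apply (sum_n_plus (G := R_AbelianMonoid))|].
apply sum_n_ext; intros j.
unfold plus; simpl; ring.
Qed.

Lemma legendre_span_scal n c f :
  legendre_span n f -> legendre_span n (fun x => c * f x).
Proof.
intros [d Hd]; exists (fun j => c * d j); intros x.
rewrite Hd; etransitivity; [symmetry; apply (sum_n_mult_l (K := R_Ring))|].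
apply sum_n_ext; intros j.
unfold mult; simpl; ring.
Qed.

Lemma legendre_span_S n f : legendre_span n f -> legendre_span (S n) f.
Proof.
intros [d Hd]; exists (fun j => if Nat.leb j n then d j else 0); intros x.
rewrite Hd, sum_Sn, (proj2 (Nat.leb_gt (S n) n)) by lia.
rewrite Rmult_0_l; symmetry; etransitivity; [apply Rplus_0_r|].
apply sum_n_ext_loc; intros j Hj.
now rewrite (proj2 (Nat.leb_le j n)).
Qed.

Lemma legendre_span_self n : legendre_span n (legendre n).
Proof.
exists (fun j => if Nat.eqb j n then 1 else 0); intros x.
rewrite (sum_n_single _ n n); [|lia|].
- rewrite Nat.eqb_refl; ring.
- intros i Hi; rewrite (proj2 (Nat.eqb_neq i n)) by auto; apply Rmult_0_l.
Qed.

(** Bonnet's recurrence re-expands each product with x, raising the top degree by one; it yields the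
    expansions of the monomials. *)
Lemma legendre_span_mul_x n f :
  legendre_span n f -> legendre_span (S n) (fun x => x * f x).
Proof.
intros [d Hd].
apply legendre_span_ext with (fun x => x * sum_n (fun j => d j * legendre j x) n).
{ intros x; now rewrite Hd. }
clear f Hd; induction n as [|n IH].
- apply legendre_span_ext with (2 := legendre_span_scal 1 (d O) _ (legendre_span_self 1)).
  intros x; rewrite sum_O; unfold legendre; simpl; field.
- apply legendre_span_ext with (fun x =>
    x * sum_n (fun j => d j * legendre j x) n
    + (d (S n) * (INR (S (S n)) / INR (2 * n + 3)) * legendre (S (S n)) x
       + d (S n) * (INR (S n) / INR (2 * n + 3)) * legendre n x)).
  + intros x; rewrite sum_Sn; set (A := sum_n _ n).
    transitivity (x * A + d (S n) * (x * legendre (S n) x)).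
    * rewrite legendre_bonnet; ring.
    * change (x * A + d (S n) * (x * legendre (S n) x)
        = x * (A + d (S n) * legendre (S n) x)); ring.
  + apply legendre_span_plus; [now apply legendre_span_S|].
    apply legendre_span_plus; apply legendre_span_scal.
    * apply legendre_span_self.
    * apply legendre_span_S, legendre_span_S, legendre_span_self.
Qed.

Lemma legendre_span_poly n (a : nat -> R) :
  legendre_span n (fun x => sum_n (fun i => x ^ i * a i) n).
Proof.
assert (Hp : forall k, legendre_span k (fun x => x ^ k)).
{ induction k as [|k IH].
  - apply legendre_span_ext with (2 := legendre_span_self 0); reflexivity.
  - exact (legendre_span_mul_x _ _ IH). }
induction n as [|n IH].
- apply legendre_span_ext with (2 := legendre_span_scal _ (a O) _ (Hp O)).
  intros x; rewrite sum_O; apply Rmult_comm.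
- apply legendre_span_ext with
    (2 := legendre_span_plus _ _ _ (legendre_span_S _ _ IH)
            (legendre_span_scal _ (a (S n)) _ (Hp (S n)))).
  intros x; rewrite sum_Sn, (Rmult_comm (a (S n))); reflexivity.
Qed.

(** Expand [Phat n] in the concrete family. Orthogonality to the lower degrees, where both families
    already agree, kills all coefficients but the last, and the value at 1 fixes that one. The norm
    [w] of [legendre j] is read off from [legendre_norm] for [Phat j], so it never has to be
    computed. *)
Lemma is_legendre_unique (Phat : nat -> R -> R) :
  is_legendre Phat -> forall n x, Phat n x = legendre n x.
Proof.
intros H n; induction n as [n IH] using lt_wf_ind.
destruct (legendre_degree _ H n) as [a [_ Ha]].
destruct (legendre_span_poly n a) as [d Hd].
assert (Hn : forall x, Phat n x = sum_n (fun j => d j * legendre j x) n).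
{ intros x; rewrite Ha; apply Hd. }
assert (Hz : forall j, (j < n)%nat -> d j = 0).
{ intros j Hj.
  set (w := 2 / (2 * INR j + 1)).
  assert (Hw : w <> 0).
  { assert (0 <= INR j) by apply pos_INR.
    apply Rgt_not_eq, Rdiv_lt_0_compat; lra. }
  assert (I1 : is_RInt (fun x => Phat n x * Phat j x) (-1) 1
     (sum_n (fun i => if Nat.eqb i j then d i * w else 0) n)).
  { apply is_RInt_ext with
      (fun x => sum_n (fun i => scal (d i) (legendre i x * legendre j x)) n).
    - intros x _; rewrite Hn, IH by auto.
      etransitivity; [|apply (sum_n_mult_r (K := R_Ring))].
      apply sum_n_ext; intros i; unfold scal, mult; simpl; unfold mult; simpl; ring.
    - apply (is_RInt_sum_n (V := R_NormedModule)); intros i.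
      destruct (Nat.eqb_spec i j) as [->|Hij].
      + apply (is_RInt_scal (V := R_NormedModule)).
        apply is_RInt_ext with (2 := legendre_norm _ H j).
        intros x _; rewrite IH by auto.
        change (legendre j x ^ 2 = legendre j x * legendre j x); ring.
      + rewrite <- (Rmult_0_r (d i)).
        apply (is_RInt_scal (V := R_NormedModule)), legendre_orthogonality; auto. }
  (* [I0] and [I1] evaluate the same integral, as 0 and as [d j * w]. *)
  assert (I0 := legendre_orthogonal _ H n j ltac:(lia)).
  apply (is_RInt_unique (V := R_CompleteNormedModule)) in I0, I1.
  rewrite I0, (sum_n_single _ j n) in I1 by
    (lia || (intros i Hi; now rewrite (proj2 (Nat.eqb_neq i j)))).
  rewrite Nat.eqb_refl in I1.
  destruct (Rmult_integral _ _ (eq_sym I1)); auto; contradiction. }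
assert (Hdn : forall x, Phat n x = d n * legendre n x).
{ intros x; rewrite Hn.
  rewrite (sum_n_ext_loc _ (fun j => if Nat.eqb j n then d n * legendre n x else 0)).
  - rewrite (sum_n_single _ n n), Nat.eqb_refl; auto.
    intros i Hi; now rewrite (proj2 (Nat.eqb_neq i n)).
  - intros j Hj; destruct (Nat.eqb_spec j n) as [->|Hjn]; [reflexivity|].
    rewrite Hz by lia; apply Rmult_0_l. }
assert (H1 := Hdn 1).
rewrite (legendre_at_1 _ H), legendre_at_plus1 in H1.
intros x; rewrite Hdn, <- (Rmult_1_r (d n)), <- H1; ring.
Qed.

(** * Coefficient sequences as functions *)

Lemma ball_sum_n {V : NormedModule R_AbsRing} (a : nat -> V) (n m : nat) (eps : R) :
  (n <= m)%nat -> norm (sum_n_m a (S n) m) < eps ->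
  ball (sum_n a n) eps (sum_n a m).
Proof.
intros Hnm H; apply norm_compat1.
exact (eq_rect _ (fun z => norm z < eps) H _ (sum_n_m_sum_n a n m Hnm)).
Qed.

(** Weierstrass M-test, phrased as a limit in the uniform space of functions because
    [filterlim_switch_1] and [filterlim_RInt] take that form. *)
Lemma uniform_series_cv {V : CompleteNormedModule R_AbsRing}
    (f : nat -> R -> V) (M : nat -> R) :
  (forall n x, norm (f n x) <= M n) -> ex_series M ->
  exists g : fct_UniformSpace R V,
    filterlim (fun N x => sum_n (fun n => f n x) N) eventually (locally g).
Proof.
intros Hf HM.
apply (filterlim_locally_cauchy (U := @fct_CompleteSpace R V)).
intros eps.
destruct (Cauchy_ex_series (V := R_CompleteNormedModule) M HM eps) as [N HN].
exists (fun n => (N <= n)%nat); split; [now exists N|].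
assert (H : forall u v, (N <= u <= v)%nat -> forall x,
  ball (sum_n (fun n => f n x) u) eps (sum_n (fun n => f n x) v)).
{ intros u v Huv x.
  destruct (Nat.eq_dec u v) as [->|Hne]; [apply ball_center|].
  apply (ball_sum_n (V := CompleteNormedModule.NormedModule _ V)); [lia|].
  apply Rle_lt_trans with (2 := HN (S u) v ltac:(lia) ltac:(lia)).
  eapply Rle_trans; [apply norm_sum_n_m|].
  eapply Rle_trans; [apply sum_n_m_le; intros n; apply Hf|].
  apply Rle_abs. }
intros u v Hu Hv x.
destruct (Nat.le_ge_cases u v); [|apply ball_sym]; apply H; lia.
Qed.

(** [P_eval] multiplies in the field C, whereas integrals take values in C as a normed space over R;
    this and [C_R_normE] translate between the two. *)
Lemma C_R_scalE (r : R) (z : C) :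
  @scal R_Ring C_R_ModuleSpace r z = Cmult z (RtoC r).
Proof.
destruct z as [x y]; unfold scal; simpl; unfold prod_scal, Cmult, scal; simpl.
unfold mult; simpl; f_equal; ring.
Qed.

Lemma C_R_normE (z : C) : @norm R_AbsRing C_R_NormedModule z = Cmod z.
Proof.
unfold Cmod, norm; simpl; unfold prod_norm, norm; simpl; unfold abs; simpl.
now rewrite !Rmult_1_r, <- !Rabs_mult, !Rabs_pos_eq by apply Rle_0_sqr.
Qed.

Lemma mapped_legendre_bound T n t :
  0 < T -> 0 <= t <= T -> Rabs (mapped_legendre T legendre n t) <= 1.
Proof.
intros HT Ht; apply legendre_bound.
assert (0 <= t / T) by (apply Rdiv_le_0_compat; lra).
assert (t / T <= 1) by (apply Rle_div_l; lra).
unfold Rdiv in *; nra.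
Qed.

(* The series of [P_eval] may diverge outside [[0, T]], where its value is junk;
   composing with [clamp T] gives a function that is continuous on all of [R]. *)
Definition clamp (T t : R) : R := Rmax 0 (Rmin t T).

Lemma clamp_bounds T t : 0 < T -> 0 <= clamp T t <= T.
Proof.
intros HT; unfold clamp; split; [apply Rmax_l|].
apply Rmax_lub; [lra|apply Rmin_r].
Qed.

Lemma clamp_id T t : 0 <= t <= T -> clamp T t = t.
Proof. intros Ht; unfold clamp; rewrite Rmin_left, Rmax_right; lra. Qed.

Lemma continuous_clamp T t : continuous (clamp T) t.
Proof.
apply filterlim_locally; intros eps; exists eps; intros s Hs.
apply Rle_lt_trans with (2 := Hs); unfold clamp.
change (Rabs (Rmax 0 (Rmin s T) - Rmax 0 (Rmin t T)) <= Rabs (s - t)).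
unfold Rmax, Rmin, Rabs; repeat destruct Rle_dec; repeat destruct Rcase_abs; lra.
Qed.

Lemma P_series_term T y t n : 0 < T -> 0 <= t <= T ->
  @norm R_AbsRing C_R_NormedModule
    (scal (mapped_legendre T legendre n t) (y n)) <= Cmod (y n).
Proof.
intros HT Ht; eapply Rle_trans; [apply (@norm_scal R_AbsRing)|].
rewrite C_R_normE; rewrite <- (Rmult_1_l (Cmod (y n))) at 2.
apply Rmult_le_compat_r; [apply Cmod_ge_0|].
now apply mapped_legendre_bound.
Qed.

Lemma P_eval_unique T y t l :
  @is_series R_AbsRing C_R_NormedModule
    (fun n => scal (mapped_legendre T legendre n t) (y n)) l ->
  P_eval T legendre y t = l.
Proof.
intros H; apply CSeries_unique.
refine (filterlim_ext _ _ _ H); intros N.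
apply (sum_n_ext (G := C_AbelianMonoid)); intros n; apply C_R_scalE.
Qed.

Lemma is_series_P_eval T y t : 0 < T -> in_P y -> 0 <= t <= T ->
  @is_series R_AbsRing C_R_NormedModule
    (fun n => scal (mapped_legendre T legendre n t) (y n))
    (P_eval T legendre y t).
Proof.
intros HT Hy Ht.
destruct (ex_series_le (V := C_R_CompleteNormedModule)
  (fun n => scal (mapped_legendre T legendre n t) (y n)) (fun n => Cmod (y n)))
  as [l Hl]; auto.
- intros n; now apply P_series_term.
- now rewrite (P_eval_unique _ _ _ _ Hl).
Qed.

Lemma P_eval_uniform T y : 0 < T -> in_P y ->
  filterlim
    (fun N s => sum_n (fun n => scal (mapped_legendre T legendre n (clamp T s)) (y n)) N)
    eventually
    (locally (T := fct_UniformSpace R C_R_CompleteNormedModule)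
       (fun s => P_eval T legendre y (clamp T s))).
Proof.
intros HT Hy.
destruct (uniform_series_cv (V := C_R_CompleteNormedModule)
  (fun n s => scal (mapped_legendre T legendre n (clamp T s)) (y n))
  (fun n => Cmod (y n))) as [g Hg]; auto.
{ intros n s; apply P_series_term; auto; now apply clamp_bounds. }
assert (HgB := proj1 (filterlim_locally _ _) Hg).
apply (filterlim_locally (U := fct_UniformSpace R C_R_CompleteNormedModule)).
intros eps; generalize (HgB eps); apply filter_imp.
intros N HN s.
(* The M-test only provides some uniform limit [g]; uniform convergence implies pointwise
   convergence, which identifies it. *)
rewrite (P_eval_unique T y (clamp T s) (g s)); [apply HN|].
apply (filterlim_locally (U := C_R_CompleteNormedModule)).
intros e; generalize (HgB e); apply filter_imp.
intros n Hn; apply Hn.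
Qed.

Lemma continuous_sum_n {U : UniformSpace} {V : NormedModule R_AbsRing}
    (f : nat -> U -> V) (N : nat) (x : U) :
  (forall n, continuous (f n) x) ->
  continuous (fun s => sum_n (fun n => f n s) N) x.
Proof.
intros Hf; induction N as [|N IH].
- apply continuous_ext with (2 := Hf O); intros s; now rewrite sum_O.
- apply continuous_ext with (2 := continuous_plus _ _ _ IH (Hf (S N))).
  intros s; now rewrite sum_Sn.
Qed.

Lemma continuous_mapped_legendre T n t :
  continuous (mapped_legendre T legendre n) t.
Proof.
apply (continuous_comp (fun t => 2 * t / T - 1) (legendre n)).
- apply (ex_derive_continuous (V := R_NormedModule)).
  auto_derive; exact I.
- apply continuous_legendre.
Qed.

Lemma continuous_P_eval_clamp T y s : 0 < T -> in_P y ->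
  @continuous R_UniformSpace C_R_NormedModule
    (fun s => P_eval T legendre y (clamp T s)) s.
Proof.
intros HT Hy.
refine (filterlim_switch_1 _ _ _ _ _ _
  (fun N => sum_n (fun n => scal (mapped_legendre T legendre n (clamp T s)) (y n)) N)
  _ (P_eval_uniform T y HT Hy) _ _).
- intros N; apply (continuous_sum_n (V := C_R_NormedModule)
    (fun n s => scal (mapped_legendre T legendre n (clamp T s)) (y n))).
  intros n.
  apply (continuous_scal_l (V := C_R_NormedModule)
    (fun s => mapped_legendre T legendre n (clamp T s))).
  apply (continuous_comp (clamp T) (mapped_legendre T legendre n)).
  + apply continuous_clamp.
  + apply continuous_mapped_legendre.
- exact (is_series_P_eval T y (clamp T s) HT Hy (clamp_bounds T s HT)).
Qed.

(** * Integration *)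

(** [T / 2] is the Jacobian of the map from [-1,1] to [0,T]; the odd number comes from
    [dlegendre_SS]. *)
Definition int_coef (T : R) (n : nat) : R := T / 2 / INR (2 * n + 1).

(* Columns: the integral of [P_n] from [0] is [c_n (P_(n+1) - P_(n-1))] for
   [n > 0] and [c_0 (P_1 + P_0)] for [n = 0], where [c_n = int_coef T n]. *)
Definition int_matrix (T : R) (j n : nat) : C :=
  RtoC (if Nat.eqb j (S n) then int_coef T n
        else if Nat.eqb n (S j) then - int_coef T n
        else if Nat.eqb (j + n) 0 then int_coef T 0
        else 0).

Lemma banded_int_matrix T : banded 1 (int_matrix T).
Proof.
intros j n H; unfold int_matrix.
destruct (Nat.eqb_spec j (S n)); [lia|].
destruct (Nat.eqb_spec n (S j)); [lia|].
destruct (Nat.eqb_spec (j + n) 0); [lia|reflexivity].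
Qed.

Lemma int_matrix_vec_0 T y :
  mat_vec (int_matrix T) y 0
  = Cplus (Cmult (RtoC (int_coef T 0)) (y O))
          (Cmult (RtoC (- int_coef T 1)) (y 1%nat)).
Proof.
rewrite (mat_vec_banded 1) by apply banded_int_matrix.
simpl Nat.add; rewrite sum_Sn, sum_O; reflexivity.
Qed.

Lemma int_matrix_vec_S T y j :
  mat_vec (int_matrix T) y (S j)
  = Cplus (Cmult (RtoC (int_coef T j)) (y j))
          (Cmult (RtoC (- int_coef T (S (S j)))) (y (S (S j)))).
Proof.
rewrite (mat_vec_banded 1) by apply banded_int_matrix.
replace (S j + 1)%nat with (S (S j)) by lia.
(* This splits off column [S (S j)]; among the remaining columns only [j] contributes. *)
rewrite sum_Sn.
rewrite (sum_n_ext_loc _ (fun n => if Nat.eqb n j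
   then Cmult (RtoC (int_coef T j)) (y j) else zero)).
- rewrite (sum_n_single _ j), Nat.eqb_refl; [|lia|].
  + f_equal; f_equal; unfold int_matrix.
    destruct (Nat.eqb_spec (S j) (S (S (S j)))); [lia|].
    now rewrite Nat.eqb_refl.
  + intros i Hi; now rewrite (proj2 (Nat.eqb_neq i j)).
- intros n Hn; unfold int_matrix.
  destruct (Nat.eqb_spec n j) as [->|Hne]; [now rewrite Nat.eqb_refl|].
  destruct (Nat.eqb_spec (S j) (S n)); [lia|].
  destruct (Nat.eqb_spec n (S (S j))); [lia|].
  apply Cmult_0_l.
Qed.

Lemma int_coef_bound T n : 0 < T -> Rabs (int_coef T n) <= T / 2.
Proof.
intros HT; unfold int_coef.
assert (1 <= INR (2 * n + 1)) by (change 1 with (INR 1); apply le_INR; lia).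
rewrite Rabs_pos_eq.
- apply Rle_div_l; [lra|]. nra.
- apply Rdiv_le_0_compat; lra.
Qed.

(** Row [S j] only involves y_j and y_(j+2), with factors at most T/2 in modulus, so a multiple of
    the series of y plus its shift dominates. Row 0 does not affect summability. *)
Lemma in_P_int_matrix T y : 0 < T -> in_P y -> in_P (mat_vec (int_matrix T) y).
Proof.
intros HT Hy; unfold in_P.
apply ex_series_incr_1.
apply (ex_series_le (V := R_CompleteNormedModule) _
  (fun j => T / 2 * Cmod (y j) + T / 2 * Cmod (y (2 + j)%nat))).
- intros j; change (Rabs (Cmod (mat_vec (int_matrix T) y (S j)))
    <= T / 2 * Cmod (y j) + T / 2 * Cmod (y (2 + j)%nat)).
  rewrite Rabs_pos_eq by apply Cmod_ge_0.
  rewrite int_matrix_vec_S; eapply Rle_trans; [apply Cmod_triangle|].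
  rewrite !Cmod_mult, !Cmod_R, Rabs_Ropp.
  apply Rplus_le_compat; (apply Rmult_le_compat_r; [apply Cmod_ge_0|]);
    now apply int_coef_bound.
- apply (ex_series_plus (V := R_NormedModule)).
  + now apply (ex_series_scal (V := R_NormedModule)).
  + apply (ex_series_scal (V := R_NormedModule)),
      (ex_series_incr_n (V := R_NormedModule) (fun j => Cmod (y j)) 2), Hy.
Qed.

(** The primitive of P_n that vanishes at 0. For n = 0 the added constant [p O t] cancels P_1(0) =
    -1. *)
Definition legendre_primitive (T : R) (n : nat) (t : R) : R :=
  let p := mapped_legendre T legendre in
  match n with
  | O => int_coef T 0 * (p 1%nat t + p O t)
  | S m => int_coef T n * (p (S n) t - p m t)
  end.

Lemma is_derive_mapped_legendre T n t : 0 < T ->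
  is_derive (mapped_legendre T legendre n) t
    (2 / T * dlegendre n (2 * t / T - 1)).
Proof.
intros HT; unfold mapped_legendre.
apply (is_derive_comp (V := R_NormedModule) (legendre n) (fun t => 2 * t / T - 1)).
- apply is_derive_legendre.
- auto_derive; [lra|field; lra].
Qed.

Lemma is_derive_legendre_primitive T n t : 0 < T ->
  is_derive (legendre_primitive T n) t (mapped_legendre T legendre n t).
Proof.
intros HT.
assert (D := fun k => is_derive_mapped_legendre T k t HT).
assert (U : forall (f : R -> R) l, is_derive f t l -> Derive (fun y => f y) t = l)
  by (intros f l; apply is_derive_unique).
destruct n as [|m]; unfold legendre_primitive; auto_derive.
- repeat split; eexists; apply D.
- rewrite (U _ _ (D 1%nat)), (U _ _ (D O)).
  unfold int_coef, mapped_legendre, dlegendre, legendre; simpl; field; lra.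
- repeat split; eexists; apply D.
- rewrite (U _ _ (D (S (S m)))), (U _ _ (D m)).
  transitivity (int_coef T (S m) * (2 / T) *
    (dlegendre (S (S m)) (2 * t / T - 1) - dlegendre m (2 * t / T - 1))); [ring|].
  rewrite dlegendre_SS; unfold int_coef, mapped_legendre.
  replace (2 * S m + 1)%nat with (2 * m + 3)%nat by lia.
  field; split; [lra|apply not_0_INR; lia].
Qed.

Lemma legendre_primitive_0 T n : 0 < T -> legendre_primitive T n 0 = 0.
Proof.
intros HT; unfold legendre_primitive, mapped_legendre.
replace (2 * 0 / T - 1) with (-1) by (field; lra).
destruct n as [|m].
- unfold legendre; simpl; field.
- rewrite legendre_SS_at_minus1; ring.
Qed.

Lemma filterlim_minus_null {T : Type} {V : NormedModule R_AbsRing}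
    {F : (T -> Prop) -> Prop} {FF : Filter F} (f e : T -> V) (l : V) :
  filterlim f F (locally l) ->
  filterlim (fun x => norm (e x)) F (locally 0) ->
  filterlim (fun x => minus (f x) (e x)) F (locally l).
Proof.
intros Hf He; rewrite <- (plus_zero_r l).
refine (filterlim_comp_2 _ _ _ Hf _ (filterlim_plus _ _)).
apply filterlim_norm_zero.
refine (filterlim_ext _ _ _ He); intros x; symmetry; apply norm_opp.
Qed.

Lemma is_RInt_mapped_legendre T n (z : C) t : 0 < T ->
  @is_RInt C_R_NormedModule
    (fun s => scal (mapped_legendre T legendre n s) z) 0 t
    (scal (legendre_primitive T n t) z).
Proof.
intros HT.
assert (E : forall r : R,
  minus (G := C_R_NormedModule) (scal r z) (scal 0 z) = scal r z).
{ intros r; apply injective_projections;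
    unfold minus, plus, opp, scal; simpl;
    unfold plus, opp, scal; simpl; unfold mult; simpl; ring. }
assert (H := is_RInt_derive (V := C_R_CompleteNormedModule)
  (fun s => scal (legendre_primitive T n s) z)
  (fun s => scal (mapped_legendre T legendre n s) z) 0 t).
cbv beta in H; rewrite legendre_primitive_0 in H by auto.
refine (eq_rect _ (fun l => is_RInt _ 0 t l) (H _ _) _ (E _)); intros s _.
- apply (is_derive_scal_l (V := C_R_NormedModule) (legendre_primitive T n)).
  now apply is_derive_legendre_primitive.
- apply (continuous_scal_l (V := C_R_NormedModule)
    (mapped_legendre T legendre n)), continuous_mapped_legendre.
Qed.

(** Truncation leaves two boundary terms: column N also feeds row N+1, which the sum on the right
    omits, and row N uses y_(N+1), which the sum on the left omits. *)
Lemma sum_n_legendre_primitive T (y : nat -> C) t N :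
  let p := mapped_legendre T legendre in
  @sum_n C_AbelianMonoid (fun n => Cmult (y n) (RtoC (legendre_primitive T n t))) N
  = Cplus
      (@sum_n C_AbelianMonoid
         (fun j => Cmult (mat_vec (int_matrix T) y j) (RtoC (p j t))) N)
      (Cplus (Cmult (y N) (RtoC (int_coef T N * p (S N) t)))
             (Cmult (y (S N)) (RtoC (int_coef T (S N) * p N t)))).
Proof.
intros p; induction N as [|N IH].
- rewrite !sum_O, int_matrix_vec_0; unfold legendre_primitive; fold p.
  rewrite !RtoC_mult, !RtoC_plus, RtoC_opp.
  match goal with |- ?a = ?b => change (@eq C a b) end; ring.
- rewrite !sum_Sn, IH, int_matrix_vec_S; unfold legendre_primitive; fold p.
  set (A := sum_n _ N); clearbody A.
  change (@plus C_AbelianMonoid) with Cplus.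
  rewrite !RtoC_mult, RtoC_minus, RtoC_opp.
  match goal with |- ?a = ?b => change (@eq C a b) end; ring.
Qed.

Lemma is_RInt_P_eval T y t : 0 < T -> in_P y -> 0 <= t <= T ->
  @is_RInt C_R_NormedModule (P_eval T legendre y) 0 t
    (P_eval T legendre (mat_vec (int_matrix T) y) t).
Proof.
intros HT Hy Ht.
set (p := mapped_legendre T legendre).
(* Clamping supplies uniform convergence on all of R; on the interval of integration it changes
   nothing. *)
destruct (filterlim_RInt (V := C_R_CompleteNormedModule)
  (fun N s => sum_n (fun n => scal (p n (clamp T s)) (y n)) N) 0 t eventually _
  (fun s => P_eval T legendre y (clamp T s))
  (fun N => sum_n (fun n => scal (legendre_primitive T n t) (y n)) N))
  as [l [Hl HI]]; [|exact (P_eval_uniform T y HT Hy)|].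
{ intros N; apply is_RInt_ext with
    (fun s => sum_n (fun n => scal (p n s) (y n)) N).
  - intros s Hs; rewrite Rmin_left, Rmax_right in Hs by lra.
    now rewrite clamp_id by lra.
  - apply (is_RInt_sum_n (V := C_R_NormedModule) (fun n s => scal (p n s) (y n))).
    intros n; now apply is_RInt_mapped_legendre. }
replace (P_eval T legendre (mat_vec (int_matrix T) y) t) with l.
{ apply is_RInt_ext with (2 := HI).
  intros s Hs; rewrite Rmin_left, Rmax_right in Hs by lra.
  now rewrite clamp_id by lra. }
symmetry; apply P_eval_unique.
(* The boundary terms of [sum_n_legendre_primitive]. They tend to 0 because their factors are
   bounded and the entries of y tend to 0. *)
set (E := fun N => plus (G := C_R_NormedModule)
  (scal (int_coef T N * p (S N) t) (y N))
  (scal (int_coef T (S N) * p N t) (y (S N)))).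
assert (HE : is_lim_seq (fun N => @norm R_AbsRing C_R_NormedModule (E N)) 0).
{ assert (L0 := ex_series_lim_0 _ Hy).
  assert (L1 := proj1 (is_lim_seq_incr_1 _ _) L0).
  apply (is_lim_seq_le_le (fun _ => 0) _
    (fun N => T / 2 * Cmod (y N) + T / 2 * Cmod (y (S N))) (Finite 0)).
  - intros N; split; [apply norm_ge_0|].
    eapply Rle_trans; [apply norm_triangle|].
    assert (B : forall n k, @norm R_AbsRing C_R_NormedModule
      (scal (int_coef T n * p k t) (y n)) <= T / 2 * Cmod (y n)).
    { intros n k; eapply Rle_trans; [apply (@norm_scal R_AbsRing)|].
      rewrite C_R_normE; apply Rmult_le_compat_r; [apply Cmod_ge_0|].
      change (Rabs (int_coef T n * p k t) <= T / 2).
      rewrite Rabs_mult, <- (Rmult_1_r (T / 2)).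
      apply Rmult_le_compat; try apply Rabs_pos.
      - now apply int_coef_bound.
      - now apply mapped_legendre_bound. }
    apply Rplus_le_compat; apply B.
  - apply is_lim_seq_const.
  - replace 0 with (T / 2 * 0 + T / 2 * 0) by ring.
    apply is_lim_seq_plus'; now apply (is_lim_seq_scal_l _ _ (Finite 0)). }
assert (HM : filterlim (fun N => minus (G := C_R_NormedModule)
    (sum_n (fun n => scal (legendre_primitive T n t) (y n)) N) (E N))
    eventually (locally l)).
{ exact (filterlim_minus_null (V := C_R_NormedModule) _ E l Hl HE). }
refine (filterlim_ext _ _ _ HM); intros N.
change (Cminus
  (@sum_n C_AbelianMonoid
    (fun n => @scal R_Ring C_R_ModuleSpace (legendre_primitive T n t) (y n)) N)
  (Cplus (@scal R_Ring C_R_ModuleSpace (int_coef T N * p (S N) t) (y N))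
         (@scal R_Ring C_R_ModuleSpace (int_coef T (S N) * p N t) (y (S N))))
  = @sum_n C_AbelianMonoid
      (fun n => @scal R_Ring C_R_ModuleSpace (p n t) (mat_vec (int_matrix T) y n)) N).
rewrite !C_R_scalE.
rewrite (sum_n_ext (G := C_AbelianMonoid) _ _ N
  (fun n => C_R_scalE (p n t) (mat_vec (int_matrix T) y n))).
rewrite (sum_n_ext (G := C_AbelianMonoid) _ _ N
  (fun n => C_R_scalE (legendre_primitive T n t) (y n))).
rewrite sum_n_legendre_primitive; fold p.
match goal with |- ?a = ?b => change (@eq C a b) end; ring.
Qed.

(** * Banded matrices and convolution *)

Lemma banded_le b b' A : (b <= b')%nat -> banded b A -> banded b' A.
Proof. intros Hb HA j n Hjn; apply HA; lia. Qed.

(** Allows any sufficiently large cut-off, so that sums for different rows can share one range and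
    be interchanged. *)
Lemma mat_vec_sum b A v j N : banded b A -> (j + b <= N)%nat ->
  mat_vec A v j = @sum_n C_AbelianMonoid (fun n => Cmult (A j n) (v n)) N.
Proof.
intros HA HN; rewrite (mat_vec_banded (N - j)).
- now replace (j + (N - j))%nat with N by lia.
- apply banded_le with (2 := HA); lia.
Qed.

(** [b] is meant to be a bandwidth of [A]: row j of [A] then vanishes beyond column [j + b], and the
    product needs no infinite series. *)
Definition banded_mul (b : nat) (A B : nat -> nat -> C) (j n : nat) : C :=
  @sum_n C_AbelianMonoid (fun l => Cmult (A j l) (B l n)) (j + b).

Lemma banded_mul_banded a b A B :
  banded a A -> banded b B -> banded (a + b) (banded_mul a A B).
Proof.
intros HA HB j n Hjn; unfold banded_mul.
rewrite (sum_n_ext (G := C_AbelianMonoid) _ (fun _ => zero)).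
- rewrite (sum_n_single (G := C_AbelianMonoid) _ 0); auto; lia.
- intros l.
  destruct (Nat.le_gt_cases l (j + a)) as [H1|H1];
    [destruct (Nat.le_gt_cases j (l + a)) as [H2|H2]|].
  + rewrite (HB l n) by lia; apply Cmult_0_r.
  + rewrite (HA j l) by lia; apply Cmult_0_l.
  + rewrite (HA j l) by lia; apply Cmult_0_l.
Qed.

Lemma mat_vec_banded_mul a b A B v j :
  banded a A -> banded b B ->
  mat_vec (banded_mul a A B) v j = mat_vec A (mat_vec B v) j.
Proof.
intros HA HB.
rewrite (mat_vec_sum (a + b) _ _ _ (j + (a + b))) by
  (auto using banded_mul_banded).
rewrite (mat_vec_sum a A _ _ (j + a)) by auto.
rewrite (sum_n_ext (G := C_AbelianMonoid) _ (fun n =>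
  @sum_n C_AbelianMonoid (fun l => Cmult (Cmult (A j l) (B l n)) (v n)) (j + a))).
(* For l at most [j + a], row l of [B] ends by [l + b], within the common cut-off [j + (a + b)]. *)
- rewrite sum_n_switch.
  apply (sum_n_ext_loc (G := C_AbelianMonoid)); intros l Hl.
  rewrite (mat_vec_sum b B v l (j + (a + b))) by (auto; lia).
  etransitivity; [|apply (sum_n_mult_l (K := C_Ring))].
  apply (sum_n_ext (G := C_AbelianMonoid)); intros n.
  symmetry; apply Cmult_assoc.
- intros n; symmetry; apply (sum_n_mult_r (K := C_Ring)).
Qed.

Lemma in_P_ext v w : (forall n, v n = w n) -> in_P v -> in_P w.
Proof. intros E; apply ex_series_ext; intros n; now rewrite E. Qed.

Lemma P_eval_ext T Phat v w t :
  (forall n, v n = w n) -> P_eval T Phat v t = P_eval T Phat w t.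
Proof.
intros E; unfold P_eval, CSeries; f_equal; apply Series_ext; intros n; now rewrite E.
Qed.

Lemma in_P_plus v w : in_P v -> in_P w -> in_P (fun n => Cplus (v n) (w n)).
Proof.
intros Hv Hw.
apply (ex_series_le (V := R_CompleteNormedModule) _
  (fun n => Cmod (v n) + Cmod (w n))).
- intros n; change (Rabs (Cmod (v n + w n)) <= Cmod (v n) + Cmod (w n)).
  rewrite Rabs_pos_eq by apply Cmod_ge_0; apply Cmod_triangle.
- now apply (ex_series_plus (V := R_NormedModule)).
Qed.

Lemma in_P_mult c v : in_P v -> in_P (fun n => Cmult c (v n)).
Proof.
intros Hv; apply ex_series_ext with (fun n => scal (Cmod c) (Cmod (v n))).
- intros n; symmetry; apply Cmod_mult.
- now apply (ex_series_scal (V := R_NormedModule)).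
Qed.

Lemma P_eval_plus T v w t : 0 < T -> in_P v -> in_P w -> 0 <= t <= T ->
  P_eval T legendre (fun n => Cplus (v n) (w n)) t
  = Cplus (P_eval T legendre v t) (P_eval T legendre w t).
Proof.
intros HT Hv Hw Ht; apply P_eval_unique.
refine (is_series_ext _ _ _ _
  (is_series_plus _ _ _ _ (is_series_P_eval T v t HT Hv Ht)
     (is_series_P_eval T w t HT Hw Ht))).
intros n; symmetry; apply (scal_distr_l (V := C_R_ModuleSpace)).
Qed.

Lemma P_eval_mult T c v t : 0 < T -> in_P v -> 0 <= t <= T ->
  P_eval T legendre (fun n => Cmult c (v n)) t
  = Cmult c (P_eval T legendre v t).
Proof.
intros HT Hv Ht; apply CSeries_unique.
assert (Hs : @is_series C_AbsRing C_NormedModule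
  (fun n => Cmult (v n) (RtoC (mapped_legendre T legendre n t))) (P_eval T legendre v t)).
{ refine (filterlim_ext _ _ _ (is_series_P_eval T v t HT Hv Ht)); intros N.
  apply (sum_n_ext (G := C_AbelianMonoid)); intros n; apply C_R_scalE. }
refine (is_series_ext _ _ _ _ (is_series_scal (V := C_NormedModule) c _ _ Hs)).
intros n; apply Cmult_assoc.
Qed.

(** Using [is_RInt] instead of the total [RInt] carries integrability along, so that representations
    can be added and scaled. *)
Record represents (T : R) (kappa : R -> C) (b : nat) (A : nat -> nat -> C) : Prop := {
  represents_banded : banded b A;
  represents_in_P : forall y, in_P y -> in_P (mat_vec A y);
  represents_conv : forall y t, in_P y -> 0 <= t <= T ->
    @is_RInt C_R_NormedModule
      (fun s => Cmult (kappa (t - s)) (P_eval T legendre y s)) 0 t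
      (P_eval T legendre (mat_vec A y) t)
}.

Lemma represents_ext T kappa kappa' b A :
  (forall u, kappa u = kappa' u) ->
  represents T kappa b A -> represents T kappa' b A.
Proof.
intros E [Hb HP Hc]; constructor; auto.
intros y t Hy Ht; apply is_RInt_ext with (2 := Hc y t Hy Ht).
intros s _; now rewrite E.
Qed.

Lemma represents_le T kappa b b' A : (b <= b')%nat ->
  represents T kappa b A -> represents T kappa b' A.
Proof.
intros Hle [Hb HP Hc]; constructor; auto.
now apply banded_le with b.
Qed.

Lemma represents_plus T kappa lambda b A B : 0 < T ->
  represents T kappa b A -> represents T lambda b B ->
  represents T (fun u => Cplus (kappa u) (lambda u)) b
    (fun j n => Cplus (A j n) (B j n)).
Proof.
intros HT [HbA HPA HcA] [HbB HPB HcB].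
assert (Hb : banded b (fun j n => Cplus (A j n) (B j n))).
{ intros j n Hjn; rewrite HbA, HbB by auto; apply Cplus_0_l. }
assert (E : forall y j, Cplus (mat_vec A y j) (mat_vec B y j)
  = mat_vec (fun j n => Cplus (A j n) (B j n)) y j).
{ intros y j; rewrite !(mat_vec_banded b) by auto.
  etransitivity; [symmetry; apply (sum_n_plus (G := C_AbelianMonoid))|].
  apply (sum_n_ext (G := C_AbelianMonoid)); intros n.
  symmetry; apply Cmult_plus_distr_r. }
constructor; auto.
- intros y Hy; apply (in_P_ext _ _ (E y)), in_P_plus; auto.
- intros y t Hy Ht.
  rewrite <- (P_eval_ext _ _ _ _ t (E y)), P_eval_plus by auto.
  refine (is_RInt_ext (V := C_R_NormedModule) _ _ _ _ _ _
    (is_RInt_plus _ _ _ _ _ _ (HcA y t Hy Ht) (HcB y t Hy Ht))).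
  intros s _; symmetry; apply Cmult_plus_distr_r.
Qed.

(** A complex factor is not a scalar of the real normed space in which the integral lives, hence the
    passage to real and imaginary parts. *)
Lemma is_RInt_Cmult (c : C) (f : R -> C) (a b : R) (l : C) :
  @is_RInt C_R_NormedModule f a b l ->
  @is_RInt C_R_NormedModule (fun s => Cmult c (f s)) a b (Cmult c l).
Proof.
intros H.
assert (H1 := is_RInt_fct_extend_fst f a b l H).
assert (H2 := is_RInt_fct_extend_snd f a b l H).
apply (is_RInt_fct_extend_pair (U := R_NormedModule) (V := R_NormedModule)).
- apply (is_RInt_minus (V := R_NormedModule));
    now apply (is_RInt_scal (V := R_NormedModule)).
- apply (is_RInt_plus (V := R_NormedModule));
    now apply (is_RInt_scal (V := R_NormedModule)).
Qed.

Lemma represents_mult T c kappa b A : 0 < T ->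
  represents T kappa b A ->
  represents T (fun u => Cmult c (kappa u)) b (fun j n => Cmult c (A j n)).
Proof.
intros HT [HbA HPA HcA].
assert (Hb : banded b (fun j n => Cmult c (A j n))).
{ intros j n Hjn; rewrite HbA by auto; apply Cmult_0_r. }
assert (E : forall y j, Cmult c (mat_vec A y j)
  = mat_vec (fun j n => Cmult c (A j n)) y j).
{ intros y j; rewrite !(mat_vec_banded b) by auto.
  etransitivity; [symmetry; apply (sum_n_mult_l (K := C_Ring))|].
  apply (sum_n_ext (G := C_AbelianMonoid)); intros n; apply Cmult_assoc. }
constructor; auto.
- intros y Hy; apply (in_P_ext _ _ (E y)), in_P_mult; auto.
- intros y t Hy Ht.
  rewrite <- (P_eval_ext _ _ _ _ t (E y)), P_eval_mult by auto.
  refine (is_RInt_ext (V := C_R_NormedModule) _ _ _ _ _ _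
    (is_RInt_Cmult c _ _ _ _ (HcA y t Hy Ht))).
  intros s _; apply Cmult_assoc.
Qed.

Lemma represents_one T : 0 < T ->
  represents T (fun _ => RtoC 1) 1 (int_matrix T).
Proof.
intros HT; constructor.
- apply banded_int_matrix.
- intros y Hy; now apply in_P_int_matrix.
- intros y t Hy Ht.
  apply is_RInt_ext with (2 := is_RInt_P_eval T y t HT Hy Ht).
  intros s _; symmetry; apply Cmult_1_l.
Qed.

Lemma represents_primitive T (f f' : R -> R) b A : 0 < T ->
  (forall u, is_derive f u (f' u)) -> (forall u, continuous f' u) -> f 0 = 0 ->
  represents T (fun u => RtoC (f' u)) b A ->
  represents T (fun u => RtoC (f u)) (b + 1) (banded_mul b A (int_matrix T)).
Proof.
intros HT Hf Hf' Hf0 [Hb HP Hc].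
assert (E : forall y j, mat_vec A (mat_vec (int_matrix T) y) j
    = mat_vec (banded_mul b A (int_matrix T)) y j).
{ intros y j; symmetry; apply mat_vec_banded_mul with 1%nat; auto using banded_int_matrix. }
constructor.
- apply banded_mul_banded; auto using banded_int_matrix.
- intros y Hy; apply (in_P_ext _ _ (E y)), HP, in_P_int_matrix; auto.
- intros y t Hy Ht.
  rewrite <- (P_eval_ext _ _ _ _ t (E y)).
  assert (HJ := in_P_int_matrix T y HT Hy).
  (* Extending y continuously to all of R makes its primitive [g] differentiable everywhere,
     including at the endpoints 0 and T. *)
  set (yc := fun s => P_eval T legendre y (clamp T s) : C_R_CompleteNormedModule).
  assert (Cy : forall s, continuous yc s)
    by (intros s; exact (continuous_P_eval_clamp T y s HT Hy)).
  set (g := fun s => RInt yc 0 s).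
  assert (Ig : forall s, is_RInt yc 0 s (g s))
    by (intros s; apply RInt_correct, ex_RInt_continuous; intros z _; apply Cy).
  assert (Dg : forall s, is_derive (K := R_AbsRing) (V := C_R_NormedModule) g s (yc s)).
  { intros s; apply (is_derive_RInt (V := C_R_NormedModule) yc g 0 s).
    - apply filter_forall; exact Ig.
    - apply Cy. }
  assert (Eg : forall s, 0 <= s <= T ->
      g s = P_eval T legendre (mat_vec (int_matrix T) y) s).
  { intros s Hs; apply is_RInt_unique.
    apply is_RInt_ext with (2 := is_RInt_P_eval T y s HT Hy Hs).
    intros x Hx; rewrite Rmin_left, Rmax_right in Hx by lra.
    unfold yc; now rewrite clamp_id by lra. }
  set (l := P_eval T legendre (mat_vec A (mat_vec (int_matrix T) y)) t).
  (* The s-derivative of f(t - s) is -f'(t - s). On [0,t] [g] is the function of J y, so [A] applied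
     to J y gives this integral up to sign. *)
  assert (H : is_RInt (V := C_R_CompleteNormedModule)
     (fun s => scal (- f' (t - s)) (g s)) 0 t (opp l)).
  { refine (is_RInt_ext (V := C_R_NormedModule) _ _ _ _ _ _
      (is_RInt_opp _ _ _ _ (Hc _ t HJ Ht))).
    intros s Hs; rewrite Rmin_left, Rmax_right in Hs by lra.
    rewrite Eg by lra.
    transitivity (Copp (Cmult (RtoC (f' (t - s)))
      (P_eval T legendre (mat_vec (int_matrix T) y) s))); [reflexivity|].
    rewrite C_R_scalE, RtoC_opp.
    match goal with |- ?a = ?b => change (@eq C a b) end; ring. }
  assert (HI := is_RInt_scal_derive_r (V := C_R_CompleteNormedModule)
    (fun s => f (t - s)) g (fun s => - f' (t - s)) yc 0 t (opp l)).
  assert (E0 : minus (G := C_R_NormedModule)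
      (minus (scal (f (t - t)) (g t)) (scal (f (t - 0)) (g 0))) (opp l) = l).
  { replace (g 0) with (zero (G := C_R_NormedModule)) by (symmetry; exact (RInt_point 0 yc)).
    replace (t - t) with 0 by ring; rewrite Hf0.
    apply injective_projections;
      unfold minus, plus, opp, scal, zero; simpl;
      unfold plus, opp, scal, zero; simpl; unfold mult; simpl; ring. }
  assert (HI' : is_RInt (V := C_R_CompleteNormedModule)
      (fun s => scal (f (t - s)) (yc s)) 0 t l).
  { refine (eq_rect _ (fun z => is_RInt (V := C_R_CompleteNormedModule) _ 0 t z)
      (HI _ _ _ _ H) _ E0); intros s _.
    - replace (- f' (t - s)) with (scal (-1) (f' (t - s)))
        by (unfold scal; simpl; unfold mult; simpl; ring).
      apply (is_derive_comp (V := R_NormedModule) f (fun s => t - s)); [apply Hf|].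
      auto_derive; [exact I|ring].
    - apply Dg.
    - apply (continuous_opp (V := R_NormedModule) (fun s => f' (t - s))).
      apply (continuous_comp (fun s => t - s) f'); [|apply Hf'].
      apply (ex_derive_continuous (V := R_NormedModule)); auto_derive; exact I.
    - apply Cy. }
  refine (is_RInt_ext (V := C_R_NormedModule) _ _ _ _ _ _ HI').
  intros s Hs; rewrite Rmin_left, Rmax_right in Hs by lra.
  unfold yc; rewrite clamp_id by lra.
  rewrite C_R_scalE; apply Cmult_comm.
Qed.

Lemma represents_pow T i : 0 < T ->
  exists A, represents T (fun u => RtoC (u ^ i)) (i + 1) A.
Proof.
intros HT; induction i as [|i [A HA]].
- exists (int_matrix T); exact (represents_one T HT).
- assert (Hi := INR_S_neq0 i).
  (* The primitive of u^i that vanishes at 0 carries the factor 1/(i+1), which is scaled away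
     afterwards. *)
  assert (HP : represents T (fun u => RtoC (u ^ S i / INR (S i))) (S i + 1)
      (banded_mul (i + 1) A (int_matrix T))).
  { replace (S i + 1)%nat with (i + 1 + 1)%nat by lia.
    apply represents_primitive with (fun u => u ^ i); auto.
    - intros u; remember (INR (S i)) as N eqn:HN.
      auto_derive; [auto|].
      change (match i with 0%nat => 1 | S _ => INR i + 1 end) with (INR (S i)).
      simpl pred; rewrite <- HN; field; auto.
    - intros u; apply (ex_derive_continuous (V := R_NormedModule)).
      auto_derive; exact I.
    - simpl; unfold Rdiv; ring. }
  exists (fun j n => Cmult (RtoC (INR (S i)))
    (banded_mul (i + 1) A (int_matrix T) j n)).
  refine (represents_ext _ _ _ _ _ _ (represents_mult _ (RtoC (INR (S i))) _ _ _ HT HP)).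
  intros u; rewrite <- RtoC_mult; f_equal; field; auto.
Qed.

Lemma represents_poly T (a : nat -> C) m : 0 < T ->
  exists A, represents T
    (fun u => @sum_n C_R_ModuleSpace (fun i => scal (u ^ i) (a i)) m) (m + 1) A.
Proof.
intros HT.
assert (Hp : forall i, exists A, represents T
    (fun u => @scal R_Ring C_R_ModuleSpace (u ^ i) (a i)) (i + 1) A).
{ intros i; destruct (represents_pow T i HT) as [A HA].
  exists (fun j n => Cmult (a i) (A j n)).
  refine (represents_ext _ _ _ _ _ _ (represents_mult _ (a i) _ _ _ HT HA)).
  intros u; symmetry; apply C_R_scalE. }
induction m as [|m [A HA]].
- destruct (Hp O) as [A HA]; exists A.
  refine (represents_ext _ _ _ _ _ _ HA); intros u; now rewrite sum_O.
- destruct (Hp (S m)) as [B HB].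
  eexists; refine (represents_ext _ _ _ _ _ _
    (represents_plus _ _ _ _ _ _ HT
      (represents_le _ _ _ (S m + 1) _ _ HA) HB)); [|lia].
  intros u; now rewrite sum_Sn.
Qed.

Theorem proposition3p1
  (Phat : nat -> R -> R) (HPhat : is_legendre Phat)
  (T : R) (HT : 0 < T)
  (k : nat -> C) (Hk : in_P k)
  (Hkfin : exists N : nat, forall n : nat, (N <= n)%nat -> k n = RtoC 0)
  (m : nat) (Hm : is_poly_of_degree C_R_ModuleSpace (P_eval T Phat k) m) :
  exists V : nat -> nat -> C,
    banded (m + 2) V /\
    (forall y : nat -> C, in_P y -> in_P (mat_vec V y)) /\
    (forall y : nat -> C, in_P y ->
       forall t : R, 0 <= t <= T ->
         convolution (P_eval T Phat k) (P_eval T Phat y) t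
         = P_eval T Phat (mat_vec V y) t).
Proof.
assert (EP : forall v t, P_eval T Phat v t = P_eval T legendre v t).
{ intros v t; unfold P_eval, CSeries, mapped_legendre.
  f_equal; apply Series_ext; intros n; now rewrite (is_legendre_unique Phat). }
destruct Hm as [a [_ Ha]].
(* The kernel enters through its monomial coefficients [a], because the matrices are built from
   powers of u. *)
destruct (represents_poly T a m HT) as [V HV].
apply (represents_le _ _ _ (m + 2)) in HV; [|lia].
destruct HV as [Hb HP Hc].
exists V; split; [exact Hb|split; [exact HP|]].
intros y Hy t Ht; rewrite EP; unfold convolution.
apply (is_RInt_unique (V := C_R_CompleteNormedModule)).
apply is_RInt_ext with (2 := Hc y t Hy Ht).
intros s _; now rewrite Ha, EP.
Qed.
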